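(* Let $(S(t,s;\omega))_{t\ge s,\ \omega\in\Omega}$ be an asymptotically compact stochastic flow on the Polish space $X$ over the probability space $(\Omega,\mathscr{F},\mathbb{P})$. Then there exists an evolution system of measures for $S$.
   Context: $(\Omega,\mathscr{F},\mathbb{P})$ is a probability space, $(X,d)$ a (nonempty) Polish (complete separable metric) space with Borel $\sigma$-algebra $\mathscr{B}(X)$. Stochastic flow: a family of maps $S(t,s;\omega):X\to X$, $-\infty<s\le t<\infty$, $\omega\in\Omega$, such that for $\mathbb{P}$-a.e. $\omega$: (i) $S(t,r;\omega)S(r,s;\omega)=S(t,s;\omega)$ for all $s\le r\le t$; (ii) $x\mapsto S(t,s;\omega)x$ is continuous for all $s\le t$; (iii) for all $t\in\mathbb{R}$, $x\in X$ the mapping $(s,\omega)\mapsto S(t,s;\omega)x$ is measurable from $((-\infty,t]\times\Omega,\mathscr{B}((-\infty,t])\otimes\mathscr{F})$ to $(X,\mathscr{B}(X))$; (iv) $S(t,t;\omega)=\mathrm{id}_X$ for all $t\in\mathbb{R}$. Given $t\in\mathbb{R}$ and $\omega\in\Omega$, a set $K(t,\omega)\subset X$ is an attracting set if for every non-empty bounded set $B\subset X$, $d(S(t,s;\omega)B,K(t,\omega))\to0$ as $s\to-\infty$, where $d(A,B):=\sup_{x\in A}\inf_{y\in B}d(x,y)$. The stochastic flow is asymptotically compact if there exists a measurable set $\Omega_0$ of measure one such that for all $t\in\mathbb{R}$ and $\omega\in\Omega_0$ there exists a compact attracting set $K(t,\omega)$. An evolution system of measures for the stochastic flow $S$ is a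 family $\{\mu_s\}_{s\in\mathbb{R}}$ of probability measures on $(\Omega\times X,\mathscr{F}\otimes\mathscr{B}(X))$, each with marginal $\mathbb{P}$ on $\Omega$, such that $S(t,s;\cdot)\mu_s=\mu_t$ for all $s\le t$, where $S(t,s;\cdot)\mu_s$ is the image of $\mu_s$ under the map $(\omega,x)\mapsto(\omega,S(t,s;\omega)x)$. *)

(* Defs.v *)
From HB Require Import structures.
From mathcomp Require Import all_boot all_order all_algebra.
From mathcomp Require Import all_classical all_reals all_analysis.
From mathcomp Require Import measurable_realfun.

Set Implicit Arguments.
Unset Strict Implicit.
Unset Printing Implicit Defensive.
Import Order.TTheory GRing.Theory Num.Theory.
Import numFieldNormedType.Exports.
Local Open Scope classical_set_scope.
Local Open Scope ring_scope.

(* The structure [Complete] extends [Pointed], so these spaces are nonempty. *)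
#[short(type="completeMetricType")]
HB.structure Definition CompleteMetric (R : numDomainType) :=
  {T of Complete T & Metric R T}.

Definition separable (T : topologicalType) :=
  exists2 A : set T, countable A & dense A.

Notation borel X := (g_sigma_algebraType (@open X)).

Section metric_notions.
Context {R : realType} {X : metricType R}.

Definition metric_bounded (B : set X) :=
  exists M : R, forall x y, B x -> B y -> mdist x y <= M.

(* Extended-real valued: the value is +oo if A is nonempty and B is empty. *)
Definition hausdorff_semidist (A B : set X) : \bar R :=
  ereal_sup [set ereal_inf [set (mdist x y)%:E | y in B] | x in A].

End metric_notions.

Section image_measure.
Context {R : realType} d1 d2 (T1 : measurableType d1) (T2 : measurableType d2).

(* [nu] is the image of the completion of [mu] under [f]. Completion is needed
   because a stochastic flow is continuous in space only for almost every
   omega, so that (omega, x) |-> (omega, S(t,s;omega)x) is in general measurable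
   only up to a null set. *)
Definition is_image_measure (mu : probability T1 R) (f : T1 -> T2)
    (nu : probability T2 R) :=
  forall B : set T2, measurable B ->
    completed_algebra_gen mu (f @^-1` B) /\
    @completed_measure_extension _ _ _ mu (f @^-1` B) = nu B.

(* For a measurable map this is the usual push-forward. *)
Lemma is_image_measureP (mu : probability T1 R) (f : T1 -> T2)
    (nu : probability T2 R) : measurable_fun setT f ->
  is_image_measure mu f nu <->
  forall B, measurable B -> pushforward mu f B = nu B.
Proof.
move=> mf; have mfB B : measurable B -> measurable (f @^-1` B).
  by move=> mB; rewrite -[X in measurable X]setTI; exact: mf.
split=> [h B mB|h B mB].
  by have [_ <-] := h B mB; rewrite /completed_measure_extension
    measurable_mu_extE//; exact: mfB.
split.
  exists (f @^-1` B); first exact: mfB.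
  by exists set0; [exact: negligible_set0|rewrite setU0].
by rewrite -h// /completed_measure_extension measurable_mu_extE//; exact: mfB.
Qed.

End image_measure.

Section stochastic_flow.
Context {R : realType} d (Omega : measurableType d) (P : probability Omega R).
Context (X : completeMetricType R).

(* [S t s omega x] stands for S(t,s;omega)x; its values for t < s are
   irrelevant. *)
Implicit Type S : R -> R -> Omega -> X -> X.

Definition stochastic_flow S :=
  [/\ {ae P, forall omega, forall s r t : R, s <= r -> r <= t ->
         forall x, S t r omega (S r s omega x) = S t s omega x},
      {ae P, forall omega, forall s t : R, s <= t -> continuous (S t s omega)},
      forall (t : R) (x : X),
        measurable_fun
          ([set` `]-oo, t]] `*` [set: Omega] : set (measurableTypeR R * Omega))
          (fun p => S t p.1 p.2 x : borel X) &
      {ae P, forall omega, forall (t : R) x, S t t omega x = x}].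

Definition attracting_set S (t : R) (omega : Omega) (K : set X) :=
  forall B : set X, B !=set0 -> metric_bounded B ->
    hausdorff_semidist (S t s omega @` B) K @[s --> -oo%R] --> 0%E.

Definition asymptotically_compact S :=
  exists Omega0 : set Omega,
    [/\ measurable Omega0, P Omega0 = 1%E &
        forall (t : R) omega, Omega0 omega ->
          exists K : set X, compact K /\ attracting_set S t omega K].

Definition flow_map S (t s : R) (p : Omega * borel X) : Omega * borel X :=
  (p.1, S t s p.1 p.2).

Definition evolution_system S (mu : R -> probability (Omega * borel X)%type R) :=
  (forall s (A : set Omega), measurable A -> pushforward (mu s) fst A = P A) /\
  (forall s t : R, s <= t -> is_image_measure (mu s) (flow_map S t s) (mu t)).

End stochastic_flow.

(* Main.v *)
Require Import Defs.
From mathcomp Require Import all_boot all_order all_algebra.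
From mathcomp Require Import all_classical all_reals all_analysis.
From mathcomp Require Import lra.

(** An evolution system is obtained from a single measurable random trajectory:
    measurable maps [x t : Omega -> X] such that, almost surely,
    [S t s omega (x s omega) = x t omega] for all [s <= t]. The law [mu t] of
    [omega |-> (omega, x t omega)] under [P] then has marginal [P], and is
    transported to [mu t'] by the flow from [t] to [t'].

    Such a trajectory is a limit of orbits started from a fixed point [x0] ever
    further in the past. For fixed omega the points [S t s omega x0] approach
    the compact set [K(t, omega)] as [s] tends to -oo, so they have cluster
    points; if they converge at time [s] along a sequence of starting times,
    continuity of the flow makes them converge at all later times along the
    same sequence, with limits that the flow carries to one another
    ([cvg_transport]). It is thus enough to have convergence at the times
    [-n], with [n] a natural number, along starting times [- sigma k omega]
    that depend measurably on omega.

    The random subsequence [sigma] comes from [deciding_subsequence]: given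
    countably many sequences of events, a subsequence can be chosen measurably
    along which each of these sequences of events eventually holds or
    eventually fails. It is applied to the events that the orbit is at time
    [-n] in the [i]-th member of a countable base of [X]. A sequence having a
    cluster point, and eventually inside or eventually outside every member of
    the base, converges ([cvg_of_decided]).

    Continuity of the flow in [x] only holds for almost every omega, so that the
    flow need not be jointly measurable in (omega, x). The image measure can
    nevertheless be computed because [mu s] is carried by the graph of [x s],
    which is measurable ([measurable_graph]), and on this graph the flow depends
    on omega only, through [x t] ([graph_law_image]). *)

Set Implicit Arguments.
Unset Strict Implicit.
Unset Printing Implicit Defensive.
Import Order.TTheory GRing.Theory Num.Theory.
Import numFieldNormedType.Exports.
Local Open Scope classical_set_scope.
Local Open Scope ring_scope.

(** * Countable regular bases *)

(** The closure in the second clause makes membership in an open set a limit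
    property: a limit of points of [U i] still belongs to [O]. This is what
    measurability of pointwise limits requires. *)
Definition regular_base (I : Type) (X : topologicalType) (U : I -> set X) :=
  (forall i, open (U i)) /\
  (forall x O, nbhs x O -> exists2 i, U i x & closure (U i) `<=` O).

(** Balls with small radii centred at a dense sequence; the radius is twice
    [l.+1%:R^-1] so that a point of the dense sequence at distance
    less than [l.+1%:R^-1] from [x] has [x] in the interior of its ball. *)
Lemma separable_regular_base (R : realType) (X : metricType R) :
  X -> separable X -> exists U : nat * nat -> set X, regular_base U.
Proof.
move=> x0 [A Acount Adense].
have [A0|[q]] := pfcard_geP Acount.
  have [y [_]] := Adense setT (ex_intro _ x0 I) openT.
  by rewrite A0.
exists (fun p => (ball (q p.1) (p.2.+1%:R^-1 *+ 2))°); split=> [p|x O].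
  exact: open_interior.
move=> /nbhs_ballP[e /= e0 xeO].
(* A point of the closure of the ball around [q j] is at distance less than
   [r + 2 * r + r] from [x], where [r] is [l.+1%:R^-1]. *)
have [l le4] : exists l : nat, (l.+1%:R^-1 : R) < e / 4.
  have e40 : 0 < e / 4 by rewrite divr_gt0.
  by have [l _ /(_ l (leqnn l))] := near_infty_natSinv_lt (PosNum e40);
    exists l.
set r : R := l.+1%:R^-1 in le4.
have r0 : 0 < r by rewrite invr_gt0.
have [y [xy Ay]] : (ball x r)° `&` A !=set0.
  by apply: Adense; [exists x; exact: nbhsx_ballx|exact: open_interior].
have {}xy := interior_subset xy.
have [j _ qj] := 'surj_q Ay.
exists (j, l); rewrite /= qj -/r.
  apply/nbhs_ballP; exists r => //= z xz.
  by rewrite mulr2n; apply: ball_triangle xz; exact: ball_sym.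
move=> z clz; apply: xeO.
have [w [/interior_subset yw zw]] := clz (ball z r) (nbhsx_ballx z r r0).
have xz : ball x (r + (r + r) + r) z.
  apply: ball_triangle (ball_sym zw).
  apply: ball_triangle xy _; by rewrite -mulr2n.
by apply: le_ball xz; lra.
Qed.

(** * Random subsequences along which countably many events are decided *)

Section deciding_subsequence.
Context d (T : measurableType d) (E : nat -> nat -> set T).

(** The event that the time [m] survives the first [i] selections. The [j]-th
    selection keeps the surviving times at which [E j] holds when there are
    infinitely many of these, and the surviving times at which it fails
    otherwise. *)
Fixpoint selected_times (i m : nat) : set T :=
  if i is j.+1 then
    let F := lim_sup_set (fun k => selected_times j k `&` E j k) in
    selected_times j m `&` ((E j m `&` F) `|` (~` E j m `&` ~` F))
  else setT.

Lemma measurable_selected_times i m : (forall j k, measurable (E j k)) ->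
  measurable (selected_times i m).
Proof.
move=> mE; elim: i m => [m|i IH m] /=; first exact: measurableT.
have mF : measurable (lim_sup_set (fun k => selected_times i k `&` E i k)).
  apply: bigcap_measurable; first by exists 0%N.
  move=> k _.
  by apply: bigcup_measurable => j _; exact: measurableI.
by apply: measurableI => //; apply: measurableU; apply: measurableI => //;
  exact: measurableC.
Qed.

(** If only finitely many surviving times satisfy [E i], then all but finitely
    many surviving times violate it, so neither choice exhausts the times. *)
Lemma selected_times_infinite i N w :
  exists2 m, (N <= m)%N & selected_times i m w.
Proof.
elim: i N => [|i IH] N /=; first by exists N.
set F := lim_sup_set _.
have [Fw|nFw] := pselect (F w).
  have [m /= Nm [sm Em]] := Fw N I.
  by exists m => //; split => //; left.
have [n nE] : exists n, forall m, (n <= m)%N -> selected_times i m w ->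
    ~ E i m w.
  apply: contrapT => /forallNP h; apply: nFw => n _.
  have /existsNP[m] := h n => /not_implyP[nm] /not_implyP[sm /contrapT Em].
  by exists m.
have [m + sm] := IH (maxn n N).
rewrite geq_max => /andP[nm Nm]; exists m => //; split => //.
by right; split => //; exact: nE.
Qed.

Lemma selected_times_sub i j m : (i <= j)%N ->
  selected_times j m `<=` selected_times i m.
Proof.
move=> /subnK <-; elim: (j - i)%N => [//|k IH] w.
by rewrite addSn => -[/IH].
Qed.

(** Diagonal argument: [sigma k] is the least time [m >= k] that survives the
    first [k] selections. For [k > i] all the values of [sigma k] have passed
    the selection that decides [E i]. *)
Lemma deciding_subsequence : (forall j k, measurable (E j k)) ->
  exists sigma : nat -> T -> nat,
  [/\ forall k m, measurable (sigma k @^-1` [set m]),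
      forall k w, (k <= sigma k w)%N &
      forall i w, (\forall k \near \oo, E i (sigma k w) w) \/
                  (\forall k \near \oo, ~ E i (sigma k w) w)].
Proof.
move=> mE.
pose Q k w m := (k <= m)%N && `[< selected_times k m w >].
have Qex k w : exists m, Q k w m.
  have [m km sm] := selected_times_infinite k k w.
  by exists m; apply/andP; split => //; apply/asboolP.
pose sigma k w := ex_minn (Qex k w).
have sigmaQ k w : Q k w (sigma k w) by rewrite /sigma; case: ex_minnP.
exists sigma; split.
- move=> k m.
  have mQ j : measurable [set w | Q k w j].
    rewrite /Q; case: (k <= j)%N => /=; last by rewrite set_false.
    rewrite (_ : [set _ | _] = selected_times k j).
      exact: measurable_selected_times.
    by apply/seteqP; split=> w /= /asboolP.
  rewrite (_ : _ @^-1` _ =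
      [set w | Q k w m] `&`
      \bigcap_(j in [set j | (j < m)%N]) ~` [set w | Q k w j]).
    apply: measurableI => //; apply: bigcap_measurableType => j _.
    exact: measurableC.
  apply/seteqP; split=> w /=.
    move=> <-; split=> // j /= jlt Qj; move: jlt.
    by rewrite /sigma; case: ex_minnP => n _ /(_ _ Qj);
      rewrite leqNgt => /negbTE->.
  move=> [Qm nQ]; rewrite /sigma; case: ex_minnP => n Qn /(_ _ Qm).
  by rewrite leq_eqVlt => /orP[/eqP//|nm]; case: (nQ n nm).
- by move=> k w; have /andP[] := sigmaQ k w.
- move=> i w; set F := lim_sup_set (fun k => selected_times i k `&` E i k).
  have dec k : (i < k)%N -> E i (sigma k w) w <-> F w.
    move=> ik; have /andP[_ /asboolP /(selected_times_sub ik)] := sigmaQ k w.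
    by case=> _ [] [].
  have [Fw|nFw] := pselect (F w); [left|right]; exists i.+1 => // k /= ik.
    exact/dec.
  by move=> /(dec _ ik).
Qed.

End deciding_subsequence.

(** * From cluster points to limits *)

(** A member of the base that contains the cluster point [z] is visited
    infinitely often, hence eventually never left. *)
Lemma cvg_of_decided (I : Type) (X : topologicalType) (U : I -> set X)
    (u : nat -> X) (z : X) : regular_base U ->
  (forall i, (\forall k \near \oo, U i (u k)) \/
             (\forall k \near \oo, ~ U i (u k))) ->
  cluster (u @ \oo) z -> u @ \oo --> z.
Proof.
move=> [oU bU] dec clz O /bU[i Uiz UO].
have [Uk|nUk] := dec i.
  by apply: filterS Uk => k Uk; apply/UO/subset_closure.
have nbhsU : nbhs z (U i) by apply: open_nbhs_nbhs.
by have [x [nUx Ux]] := clz (~` U i) (U i) nUk nbhsU.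
Qed.

(** The terms of the sequence need not lie in [K], so the cluster point is
    sought among nearby points of [K]. *)
Lemma cluster_near_compact (R : realType) (X : metricType R) (K : set X)
    (u : nat -> X) : compact K ->
  (forall e : R, 0 < e ->
     \forall k \near \oo, exists2 z, K z & mdist (u k) z < e) ->
  cluster (u @ \oo) !=set0.
Proof.
move=> cK uK.
have /choice[v hv] : forall n, exists p : nat * X,
    [/\ (n <= p.1)%N, K p.2 & ball (u p.1) n.+1%:R^-1 p.2].
  move=> n; have n0 : 0 < n.+1%:R^-1 :> R by rewrite invr_gt0.
  have [N _ hN] := uK _ n0.
  have [z Kz uz] := hN (maxn n N) (leq_maxr _ _).
  by exists (maxn n N, z); split => //=; rewrite ?leq_maxl// ballEmdist.
have [|z [_ clz]] := cK ((snd \o v) @ \oo) _.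
  by exists 0%N => // n _ /=; have [] := hv n.
(* A cluster point of the chosen points of [K] is one of [u], since the
   distances between these points and the terms of [u] tend to 0. *)
exists z => A B [N _ NA] /nbhs_ballP[e /= e0 zeB].
have e20 : 0 < e / 2 by rewrite divr_gt0.
have [l _ hl] := near_infty_natSinv_lt (PosNum e20).
have tail : ((snd \o v) @ \oo) ((snd \o v) @` [set n | (maxn N l <= n)%N]).
  by exists (maxn N l) => // n /= ?; exists n.
have [y [[n /= /[!geq_max]/andP[Nn ln] <-] zy]] :=
  clz _ _ tail (nbhsx_ballx z (e / 2) e20).
have [nv _ uv] := hv n.
exists (u (v n).1); split; first by apply: NA => /=; exact: leq_trans nv.
apply: zeB; rewrite [e]splitr; apply: ball_triangle zy _.
by apply: ball_sym; apply: le_ball uv; exact/ltW/hl.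
Qed.

(** * Measurability *)

(** The limit is in the open set [A] exactly when, for some member of the base
    with closure inside [A], the sequence is eventually in this member. *)
Lemma measurable_fun_limit (I : countType) (X : ptopologicalType)
    (U : I -> set X) d (T : measurableType d) (f : nat -> T -> X) (g : T -> X) :
  regular_base U ->
  (forall k, measurable_fun setT (f k : T -> borel X)) ->
  (forall w, f k w @[k --> \oo] --> g w) ->
  measurable_fun setT (g : T -> borel X).
Proof.
move=> [oU bU] mf fg.
apply: (@measurability _ _ T (borel X) setT g (@open X)) => //.
move=> _ [A oA <-]; rewrite setTI.
rewrite (_ : _ @^-1` _ = \bigcup_(i in [set i | closure (U i) `<=` A])
   \bigcup_N \bigcap_(k in [set k | (N <= k)%N]) (f k @^-1` U i)).
  rewrite bigcup_mkcond.
  apply: countable_bigcupT_measurable => // i; case: ifP => // _.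
  apply: bigcup_measurable => N _; apply: bigcap_measurableType => k _.
  rewrite -[X in measurable X]setTI.
  by apply: mf => //; exact: sub_sigma_algebra.
apply/seteqP; split=> w /=.
  move=> Agw; have [i Ui UA] := bU (g w) A (open_nbhs_nbhs (conj oA Agw)).
  have [N _ hN] := fg w _ (open_nbhs_nbhs (conj (oU i) Ui)).
  by exists i => //; exists N => // k /= /hN.
move=> [i /= UA [N _ hN]]; apply: UA => B /fg [N' _ hN'].
exists (f (maxn N N') w); split; first by apply: hN => /=; exact: leq_maxl.
by apply: hN' => /=; exact: leq_maxr.
Qed.

Lemma measurable_fun_random_index d d' (T : measurableType d)
    (T' : measurableType d') (Y : nat -> T -> T') (tau : T -> nat) :
  (forall m, measurable_fun setT (Y m)) ->
  (forall m, measurable (tau @^-1` [set m])) ->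
  measurable_fun setT (fun w => Y (tau w) w).
Proof.
move=> mY mtau _ B mB; rewrite setTI.
rewrite (_ : _ @^-1` _ = \bigcup_m (tau @^-1` [set m] `&` Y m @^-1` B)).
  apply: bigcup_measurable => m _; apply: measurableI => //.
  by rewrite -[X in measurable X]setTI; exact: mY.
apply/seteqP; split=> w /=; first by move=> Bw; exists (tau w).
by move=> [m _ [/= ->]].
Qed.

(** Off the graph, the points [g w] and [x] are separated by a member of the
    base, so the complement of the graph is a countable union of rectangles. *)
Lemma measurable_graph (I : countType) (X : ptopologicalType)
    (U : I -> set X) d (T : measurableType d) (g : T -> X) :
  hausdorff_space X -> regular_base U ->
  measurable_fun setT (g : T -> borel X) ->
  measurable [set p : T * borel X | g p.1 = p.2].
Proof.
move=> hX [oU bU] mg.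
rewrite -[X in measurable X]setCK; apply: measurableC.
rewrite (_ : ~` _ = \bigcup_i ((g @^-1` U i) `*` (~` U i : set (borel X)))).
  apply: countable_bigcupT_measurable => // i.
  have mU : measurable (U i : set (borel X)) by exact: sub_sigma_algebra.
  apply: measurableX; last exact: measurableC.
  by rewrite -[X in measurable X]setTI; exact: mg.
apply/seteqP; split=> -[w x] /= => [gx|[i _ [/= Ug nUx]] gx]; last first.
  by rewrite gx in Ug.
have [i Ug /= Ux] : exists2 i, U i (g w) & ~ U i x.
  apply: contrapT => h; apply: gx; apply: hX => A B /bU[i Ui UA] Bx.
  have Ux : U i x by apply: contrapT => nUx; apply: h; exists i.
  by exists x; split; [apply/UA/subset_closure|exact: nbhs_singleton].
by exists i.
Qed.

Lemma measurable_flow_at (R : realType) d (T : measurableType d)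
    d' (T' : measurableType d') (f : R -> T -> T') (s t : R) :
  measurable_fun
    ([set` `]-oo, t]] `*` [set: T] : set (measurableTypeR R * T))
    (fun p => f p.1 p.2) ->
  s <= t -> measurable_fun setT (f s).
Proof.
move=> mf st.
pose i (w : T) : measurableTypeR R * T := (s, w).
have mi : measurable_fun setT i by exact: pair1_measurable.
apply: (measurable_comp _ _ mf mi).
  by apply: measurableX => //; exact: measurable_itv.
by move=> _ [w _ <-]; split => //=; rewrite in_itv.
Qed.

(** * Laws carried by graphs *)

Lemma image_probability (R : realType) d d' (T : measurableType d)
    (T' : measurableType d') (P : probability T R) (f : T -> T') :
  measurable_fun setT f ->
  exists nu : probability T' R, forall A, nu A = P (f @^-1` A).
Proof.
move=> mf; pose F : {mfun T >-> T'} := mfun_Sub (mem_set mf).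
by exists (distribution P F).
Qed.

Lemma ae_measurable_set (R : realType) d (T : measurableType d)
    (P : probability T R) (Q : T -> Prop) : {ae P, forall w, Q w} ->
  exists G : set T, [/\ measurable G, P G = 1%E & forall w, G w -> Q w].
Proof.
move=> [N [mN PN QN]]; exists (~` N); split.
- exact: measurableC.
- by rewrite probability_setC// PN sube0.
- by move=> w nNw; apply: contrapT => nQ; apply/nNw/QN.
Qed.

(** The map [(w, x) |-> (w, f w x)] need not be measurable, but on the graph of
    [g], which carries [mu], and for [w] in a set [G] of full measure, it
    coincides with [(w, x) |-> (w, h w)]. Preimages of measurable sets are
    therefore measurable up to the complement of this part of the graph. *)
Lemma graph_law_image (I : countType) (R : realType) d
    (T : measurableType d) (P : probability T R)
    (X : ptopologicalType) (U : I -> set X) (g h : T -> borel X)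
    (f : T -> X -> X) (mu nu : probability (T * borel X)%type R) :
  hausdorff_space X -> regular_base U ->
  measurable_fun setT g -> measurable_fun setT h ->
  (forall A, mu A = P ((fun w => (w, g w)) @^-1` A)) ->
  (forall A, nu A = P ((fun w => (w, h w)) @^-1` A)) ->
  {ae P, forall w, f w (g w) = h w} ->
  is_image_measure mu (fun p : T * borel X => (p.1, f p.1 p.2 : borel X)) nu.
Proof.
move=> hX rU mg mh muE nuE /ae_measurable_set[G [mG PG Gfg]] B mB.
have mid : measurable_fun setT (fun w : T => w) := @measurable_id _ T setT.
have mH : measurable ((fun w => (w, h w)) @^-1` B).
  rewrite -[X in measurable X]setTI.
  have mTh := measurable_fun_pair mid mh.
  exact: (mTh measurableT B mB).
pose Gr := [set p : T * borel X | g p.1 = p.2].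
have mGr : measurable Gr by exact: measurable_graph rU mg.
pose C := G `&` (fun w => (w, h w)) @^-1` B.
have mC : measurable C by exact: measurableI.
pose A := Gr `&` (C `*` [set: borel X]).
have mA : measurable A.
  by apply: measurableI => //; exact: measurableX.
pose D := (Gr `&` (G `*` [set: borel X])).
have mD : measurable D.
  by apply: measurableI => //; exact: measurableX.
have PGI E : measurable E -> P (G `&` E) = P E.
  move=> mE.
  have PnG : P (~` G) = 0%E by rewrite probability_setC// PG subee.
  have mEG : measurable (E `\` G) by exact: measurableD.
  have EG0 : P (E `\` G) = 0%E.
    by apply: (subset_measure0 mEG (measurableC mG) _ PnG) => w [].
  rewrite -(@measureU0 _ _ _ P _ _ _ mEG EG0); last exact: measurableI.
  by rewrite setIC setUIDK.
have muA : mu A = nu B.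
  rewrite muE nuE -(PGI _ mH); congr (P _).
  by apply/seteqP; split=> w /=; [move=> [_ [[]]]|move=> [Gw Bw]].
have muDc : mu (~` D) = 0%E.
  rewrite probability_setC// muE.
  rewrite (_ : _ @^-1` _ = G) ?PG ?subee//.
  by apply/seteqP; split=> w /=; [move=> [_ []]|move=> Gw].
pose F (p : T * borel X) : T * borel X := (p.1, f p.1 p.2).
have AB : A `<=` F @^-1` B.
  by move=> [w x] [+ [[/= Gw Bw] _]]; rewrite /Gr /F /= => <-; rewrite Gfg.
have BA : F @^-1` B `<=` A `|` ~` D.
  move=> [w x]; rewrite /F /= => Bwx.
  have [[gx [Gw _]]|nD] := pselect (D (w, x)); last by right.
  left; split => //; split => //; split => //=.
  by rewrite -(Gfg _ Gw) [g w]gx.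
split.
  exists A => //; exists (F @^-1` B `\` A).
    exists (~` D); split => //; first exact: measurableC.
    by move=> p [/BA[]].
  exact: setDUK.
rewrite /completed_measure_extension; apply/eqP; rewrite eq_le -muA.
apply/andP; split; last first.
  by rewrite -measurable_mu_extE//; exact: le_mu_ext.
apply: (le_trans (le_mu_ext mu BA)).
have mDc : measurable (~` D) by exact: measurableC.
by rewrite measurable_mu_extE ?measureU0//; exact: measurableU.
Qed.

(** * Pullback limits of the flow *)

(** As soon as [tau k <= s], the orbit started at time [tau k] passes through
    time [s] before [t]. The minima keep the starting times below the final
    one, as measurability in omega requires for every [k]; they are inactive
    for large [k]. *)
Lemma cvg_transport (R : realType) (X : topologicalType)
    (phi : R -> R -> X -> X) (x0 y : X) (tau : nat -> R) (s t : R) :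
  (forall s r t : R, s <= r -> r <= t ->
     forall x, phi t r (phi r s x) = phi t s x) ->
  continuous (phi t s) -> s <= t -> tau @ \oo --> -oo%R ->
  phi s (Num.min s (tau k)) x0 @[k --> \oo] --> y ->
  phi t (Num.min t (tau k)) x0 @[k --> \oo] --> phi t s y.
Proof.
move=> phiD phiC st tauNy /(continuous_cvg _ (phiC y)); apply: cvg_trans.
apply: near_eq_cvg; have : \forall k \near \oo, tau k <= s by exact: cvgrNy_le.
apply: filterS => k ks /=; rewrite phiD ?ge_min ?lexx//.
by rewrite !min_r// (le_trans ks).
Qed.

(** A singleton is bounded, so it is attracted. *)
Lemma attracted_orbit (R : realType) d (T : measurableType d)
    (X : completeMetricType R) (S : R -> R -> T -> X -> X) (t : R) (w : T)
    (K : set X) (x0 : X) (tau : nat -> R) (e : R) : attracting_set S t w K ->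
  tau @ \oo --> -oo%R -> 0 < e ->
  \forall k \near \oo, exists2 z, K z & mdist (S t (tau k) w x0) z < e.
Proof.
move=> attK tauNy e0.
have bdd : metric_bounded [set x0].
  by exists 0 => x y -> ->; rewrite mdistxx.
have nbhs0 : nbhs (0 : \bar R)%E [set y | (y < e%:E)%E].
  exact: (@nbhs_open_ereal_lt _ 0 (fun=> e)).
have /cvge_ninftyP/(_ _ tauNy) := attK _ (ex_intro _ x0 erefl) bdd.
move=> /(_ _ nbhs0) lte_near.
near=> k.
have lte : (hausdorff_semidist (S t (tau k) w @` [set x0]) K < e%:E)%E.
  by near: k.
have /ereal_inf_lt[_ [z Kz <-]] :
    (ereal_inf [set (mdist (S t (tau k) w x0) z)%:E | z in K] < e%:E)%E.
  apply: le_lt_trans lte; apply: ereal_sup_ubound.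
  by exists (S t (tau k) w x0) => //; exists x0.
by rewrite lte_fin; exists z.
Unshelve. all: by end_near. Qed.

(** The limit is taken on a measurable set [G] of full measure on which all the
    almost sure properties hold, and is replaced by the constant [x0] elsewhere,
    which makes it measurable everywhere. *)
Lemma random_trajectory (R : realType) d (T : measurableType d)
    (P : probability T R) (X : completeMetricType R)
    (S : R -> R -> T -> X -> X) :
  separable X -> stochastic_flow P S -> asymptotically_compact P S ->
  exists x : R -> T -> X,
    (forall t, measurable_fun setT (x t : T -> borel X)) /\
    {ae P, forall w, forall s t : R, s <= t -> S t s w (x s w) = x t w}.
Proof.
move=> sepX [cocycle continuity measurability _] [T0 [mT0 PT0 compactK]].
have x0 : X := point.
have [U rU] := separable_regular_base x0 sepX.
have [oU _] := rU.
pose Y (t : R) m w := S t (Num.min t (- m%:R)) w x0.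
have mY t m : measurable_fun setT (Y t m : T -> borel X).
  apply: (measurable_flow_at (f := fun s w => (S t s w x0 : borel X))
    (measurability t x0)).
  by rewrite ge_min lexx.
(* [c] encodes a time [- n] and the index [i] of a member of the base. *)
pose E c m : set T :=
  if unpickle c is Some (n, i) then Y (- (n : nat)%:R) m @^-1` U i else set0.
have mE c m : measurable (E c m).
  rewrite /E; case: (unpickle c) => [[n i]|//].
  rewrite -[X in measurable X]setTI; apply: mY => //.
  exact: sub_sigma_algebra.
have [sigma [msigma sigma_ge dec]] := deciding_subsequence mE.
have tauNy w : - (sigma k w)%:R @[k --> \oo] --> (-oo : set_system R).
  apply/cvgNrNy; apply: (@ger_cvgy _ _ _ _ (fun k => k%:R));
    last exact: cvgr_idn.
  by apply: nearW => k; rewrite ler_nat.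
have [G [mG PG GP]] : exists G : set T, [/\ measurable G, P G = 1%E &
    forall w, G w -> [/\ forall s r t : R, s <= r -> r <= t ->
         forall x, S t r w (S r s w x) = S t s w x,
      forall s t : R, s <= t -> continuous (S t s w) & T0 w]].
  apply: ae_measurable_set.
  have T0ae : {ae P, forall w, T0 w}.
    exists (~` T0); split => //; first exact: measurableC.
    by rewrite probability_setC// PT0 subee.
  near=> w; split.
  - by near: w.
  - by near: w.
  - by near: w.
have cvgY w t : G w -> cvg (Y t (sigma k w) w @[k --> \oo]).
  move=> /GP[coc con T0w].
  have [n nt] : exists n : nat, - n%:R <= t.
    exists (Num.truncn `|t|).+1.
    have := truncnS_gt `|t|; have := ler_norm (- t); rewrite normrN; lra.
  have [K [cK attK]] := compactK (- n%:R) w T0w.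
  have minNy : Num.min (- n%:R) (- (sigma k w)%:R) @[k --> \oo] -->
      (-oo : set_system R).
    apply: ler_cvgNy (tauNy w); apply: nearW => k.
    by rewrite ge_min lexx orbT.
  have [z clz] := cluster_near_compact cK
    (fun e => attracted_orbit x0 (e := e) attK minNy).
  apply/cvg_ex; exists (S t (- n%:R) w z).
  apply: (cvg_transport (phi := fun s t => S s t w) coc (con _ _ nt) nt
    (tauNy w)).
  apply: (cvg_of_decided rU) clz => i.
  by have := dec (pickle (n, i)) w; rewrite /E pickleK.
pose x t w := if w \in G then lim (Y t (sigma k w) w @[k --> \oo]) else x0.
exists x; split=> [t|].
  pose f k w : borel X := if w \in G then Y t (sigma k w) w else x0.
  apply: (measurable_fun_limit rU (f := f)) => [k|w].
    apply: measurable_fun_ifT => //.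
      apply: (measurable_fun_bool true); rewrite setTI.
      by rewrite (_ : _ @^-1` _ = G)//; apply/seteqP;
        split=> w /= => [/set_mem|/mem_set].
    exact: (measurable_fun_random_index (T' := borel X) (mY t) (msigma k)).
  rewrite /f /x; case: ifPn => [/set_mem Gw|_]; last exact: cvg_cst.
  exact: cvgY.
exists (~` G); split; first exact: measurableC.
  by rewrite probability_setC// PG subee.
move=> w; apply: contra_not => Gw s t st.
have [coc con _] := GP w Gw.
rewrite /x mem_set//; apply/esym/cvg_lim; first exact: metric_hausdorff.
apply: (cvg_transport (phi := fun s t => S s t w) coc (con _ _ st) st
  (tauNy w)).
exact: cvgY.
Unshelve. all: by end_near. Qed.

Theorem corollary3p3 (R : realType) (d : measure_display)
    (Omega : measurableType d) (P : probability Omega R)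
    (X : completeMetricType R) (X_separable : separable X)
    (S : R -> R -> Omega -> X -> X)
    (S_flow : stochastic_flow P S)
    (S_compact : asymptotically_compact P S) :
  exists mu : R -> probability (Omega * borel X)%type R,
    evolution_system P S mu.
Proof.
have [x [mx inv_x]] := random_trajectory X_separable S_flow S_compact.
have [U rU] := separable_regular_base (point : X) X_separable.
have mid : measurable_fun setT (fun w : Omega => w) :=
  @measurable_id _ Omega setT.
have /choice[mu muE] t := image_probability P (measurable_fun_pair mid (mx t)).
exists mu; split=> [s A mA|s t st]; first by rewrite /pushforward muE.
have inv_st : {ae P, forall w, S t s w (x s w) = x t w}.
  by apply: filterS inv_x => w; exact.
exact: (graph_law_image (X := X) (@metric_hausdorff R X) rU
  (mx s) (mx t) (muE s) (muE t) inv_st).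
Qed.
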